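(* Let $0<l_2\le l_1$ be real numbers, and put $h_b^{**}=l_1l_2/\sqrt{l_1^2+l_2^2}$. For a real number $x$ consider the triangles $ABC$ with $l_a=l_2$, $l_b=l_1$ and $h_b=x$. If $h_b^{**}<x<l_1$, there exist exactly two such triangles. If $0<x\le h_b^{**}$ or $x=l_1$, there exists a unique such triangle. For all other values of $x$ no such triangle exists.
   Context: For a non-degenerate triangle $ABC$ in the Euclidean plane, $l_a$ and $l_b$ denote the lengths of the internal angle bisectors drawn from $A$ and $B$ respectively, measured from the vertex to the opposite side; $h_b$ is the length of the height (altitude) from $B$ onto the line $CA$. Triangles are counted up to congruence respecting the vertex labels. *)

(* Defs.v *)
From Stdlib Require Import Reals List.
Open Scope R_scope.

Definition point : Type := (R * R)%type.

Definition distance (P Q : point) : R :=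
  dist_euc (fst P) (snd P) (fst Q) (snd Q).

Definition vec (P Q : point) : point := (fst Q - fst P, snd Q - snd P).

Definition dot (u v : point) : R := fst u * fst v + snd u * snd v.

(** Unoriented angle PQS, between 0 and [PI]; meaningful when [P <> Q] and [S <> Q]. *)
Definition angle (P Q S : point) : R :=
  acos (dot (vec Q P) (vec Q S) / (distance Q P * distance Q S)).

Definition affine (P Q : point) (t : R) : point :=
  (fst P + t * (fst Q - fst P), snd P + t * (snd Q - snd P)).

Definition on_line (P Q X : point) : Prop := exists t : R, X = affine P Q t.

Definition on_segment (P Q X : point) : Prop :=
  exists t : R, 0 <= t <= 1 /\ X = affine P Q t.

Definition collinear (A B C : point) : Prop :=
  exists P Q : point,
    P <> Q /\ on_line P Q A /\ on_line P Q B /\ on_line P Q C.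

Record labelled_triangle : Type := Triangle {
  vA : point;
  vB : point;
  vC : point;
  nondegenerate : ~ collinear vA vB vC
}.

(** The internal bisector from [A] and the altitude from [B] of a
    non-degenerate triangle have a unique foot, so each of the following
    relations determines the length [l], respectively [h]. *)
Definition bisector_length (A B C : point) (l : R) : Prop :=
  exists D : point,
    on_segment B C D /\ angle B A D = angle D A C /\ distance A D = l.

Definition altitude_length (B C A : point) (h : R) : Prop :=
  exists H : point,
    on_line C A H /\ dot (vec B H) (vec C A) = 0 /\ distance B H = h.

Definition has_la (T : labelled_triangle) (l : R) : Prop :=
  bisector_length (vA T) (vB T) (vC T) l.

Definition has_lb (T : labelled_triangle) (l : R) : Prop :=
  bisector_length (vB T) (vC T) (vA T) l.

Definition has_hb (T : labelled_triangle) (h : R) : Prop :=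
  altitude_length (vB T) (vC T) (vA T) h.

Definition isometry (f : point -> point) : Prop :=
  forall P Q : point, distance (f P) (f Q) = distance P Q.

(** Reflections are allowed; the labels of the vertices are respected. *)
Definition congruent (S T : labelled_triangle) : Prop :=
  exists f : point -> point,
    isometry f /\ f (vA S) = vA T /\ f (vB S) = vB T /\ f (vC S) = vC T.

(** There are exactly [n] congruence classes of triangles satisfying [P]:
    [ts] is a complete list of pairwise non-congruent representatives. *)
Definition exactly_up_to_congruence (n : nat) (P : labelled_triangle -> Prop) : Prop :=
  exists ts : list labelled_triangle,
    length ts = n /\
    Forall P ts /\
    ForallOrdPairs (fun S T => ~ congruent S T) ts /\
    (forall T : labelled_triangle, P T -> Exists (congruent T) ts).

Definition hb_starstar (l1 l2 : R) : R := l1 * l2 / sqrt (l1 ^ 2 + l2 ^ 2).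

Definition prescribed (l1 l2 x : R) (T : labelled_triangle) : Prop :=
  has_la T l2 /\ has_lb T l1 /\ has_hb T x.

(* Main.v *)
Require Import Defs.
From Stdlib Require Import Reals List Lra Psatz.
From Coquelicot Require Import Coquelicot.
Open Scope R_scope.

(** Up to congruence a triangle is given by its inradius r and the tangents
    p = tan (A/2), q = tan (B/2), with p q < 1. The altitude determines r, and
    h_b = l_b sin (A + B/2), so that k = cot (A + B/2) satisfies
    x^2 (1 + k^2) = l_1^2: there are two opposite candidates for k, which coincide
    when x = l_1. For fixed k, q is a rational function of p, and

      h_b / l_a = sin A sin (B + A/2) / sin B

    is strictly increasing in p: its logarithmic derivative in A/2 is
    2 cot A - 3 cot (B + A/2) + 4 cot B > 0. It tends to infinity at the right end
    of the range of p. At the left end it tends to 0 if k >= 0, and to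
    |k| / sqrt (1 + k^2) if k < 0. So k >= 0 gives exactly one triangle, and k < 0
    gives one exactly when k^2 < (x / l_2)^2 (1 + k^2), that is, when x > h_b^**. *)

(** * Bisectors, altitudes and congruence in terms of side lengths *)

Definition cross (u v : point) : R := fst u * snd v - snd u * fst v.

Lemma distance_sq P Q :
  distance P Q ^ 2 = (fst P - fst Q) ^ 2 + (snd P - snd Q) ^ 2.
Proof.
  unfold distance, dist_euc.
  rewrite pow2_sqrt; [unfold Rsqr; ring | apply Rplus_le_le_0_compat; apply Rle_0_sqr].
Qed.

Lemma distance_ge0 P Q : 0 <= distance P Q.
Proof. apply sqrt_pos. Qed.

Lemma distance_sym P Q : distance P Q = distance Q P.
Proof. unfold distance. apply distance_symm. Qed.

Lemma pow2_inj x y : 0 <= x -> 0 <= y -> x ^ 2 = y ^ 2 -> x = y.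
Proof. intros; apply Rsqr_inj; auto; unfold Rsqr; lra. Qed.

Lemma sum_sq_eq0 x y : x ^ 2 + y ^ 2 = 0 -> x = 0 /\ y = 0.
Proof.
  intros E. apply Rplus_sqr_eq_0. unfold Rsqr. lra.
Qed.

Lemma distance_pos P Q : (fst P - fst Q) ^ 2 + (snd P - snd Q) ^ 2 <> 0 ->
  0 < distance P Q.
Proof.
  intros H. destruct (distance_ge0 P Q) as [?|E]; auto.
  exfalso; apply H. rewrite <- distance_sq, <- E. ring.
Qed.

(** [acos] is injective only on [-1, 1], so the cosine quotients must be kept there. The reason is
    Lagrange's identity |u|^2 |v|^2 - (u.v)^2 = [cross u v ^ 2]. *)
Lemma cauchy_schwarz_ratio Q P S : 0 < distance Q P -> 0 < distance Q S ->
  -1 <= dot (vec Q P) (vec Q S) / (distance Q P * distance Q S) <= 1.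
Proof.
  intros HP HS.
  assert (Hm : 0 < distance Q P * distance Q S) by nra.
  set (m := distance Q P * distance Q S) in *.
  set (d := dot (vec Q P) (vec Q S)).
  assert (Hsq : d ^ 2 <= m ^ 2).
  { assert (E : m ^ 2 = distance Q P ^ 2 * distance Q S ^ 2) by (unfold m; ring).
    rewrite E, !distance_sq. unfold d, dot, vec; simpl fst; simpl snd.
    match goal with |- ?l <= ?r =>
      assert (r - l = cross (vec Q P) (vec Q S) ^ 2)
        by (unfold cross, vec; simpl fst; simpl snd; ring) end.
    pose proof (pow2_ge_0 (cross (vec Q P) (vec Q S))). lra. }
  assert (E : d = d / m * m) by (field; lra).
  assert (- m <= d <= m) by nra.
  split; nra.
Qed.

Lemma acos_inj x y : -1 <= x <= 1 -> -1 <= y <= 1 -> acos x = acos y -> x = y.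
Proof. intros Hx Hy E. rewrite <- (cos_acos x), <- (cos_acos y), E; auto. Qed.

Lemma bisector_angle_iff A B C D :
  0 < distance A B -> 0 < distance A C -> 0 < distance A D ->
  angle B A D = angle D A C <->
  dot (vec A B) (vec A D) * distance A C = dot (vec A D) (vec A C) * distance A B.
Proof.
  intros HB HC HD. unfold angle.
  assert (E : dot (vec A B) (vec A D) / (distance A B * distance A D)
            - dot (vec A D) (vec A C) / (distance A D * distance A C)
            = (dot (vec A B) (vec A D) * distance A C
               - dot (vec A D) (vec A C) * distance A B)
              / (distance A B * distance A C * distance A D)) by (field; lra).
  split; intros H.
  - apply acos_inj in H; try (apply cauchy_schwarz_ratio; assumption).
    apply Rminus_diag_eq in H. rewrite E in H.
    apply Rminus_diag_uniq.
    apply Rmult_integral in H. destruct H as [H|H]; auto.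
    exfalso; revert H; apply Rinv_neq_0_compat.
    apply Rgt_not_eq. repeat apply Rmult_lt_0_compat; assumption.
  - f_equal. apply Rminus_diag_uniq. rewrite E.
    rewrite H. unfold Rdiv. ring.
Qed.

(** The classical l^2 = b c (1 - a^2 / (b + c)^2): the foot divides BC in the ratio c : b, and
    Stewart's theorem gives its distance from A. *)
Lemma bisector_length_iff A B C l : cross (vec A B) (vec A C) <> 0 ->
  bisector_length A B C l <->
  0 <= l /\
  l ^ 2 * (distance A C + distance A B) ^ 2 =
  distance A C * distance A B *
    ((distance A C + distance A B) ^ 2 - distance B C ^ 2).
Proof.
  intros Hcr.
  assert (Hc : 0 < distance A B).
  { apply distance_pos. intros E. apply Hcr. unfold cross, vec; simpl fst; simpl snd.
    assert (fst A - fst B = 0 /\ snd A - snd B = 0) as [] by (apply sum_sq_eq0; assumption).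
    replace (fst B) with (fst A) by lra. replace (snd B) with (snd A) by lra. ring. }
  assert (Hb : 0 < distance A C).
  { apply distance_pos. intros E. apply Hcr. unfold cross, vec; simpl fst; simpl snd.
    assert (fst A - fst C = 0 /\ snd A - snd C = 0) as [] by (apply sum_sq_eq0; assumption).
    replace (fst C) with (fst A) by lra. replace (snd C) with (snd A) by lra. ring. }
  assert (Hd : forall t, 0 < distance A (affine B C t)).
  { intros t. apply distance_pos. intros E. apply Hcr.
    unfold cross, vec, affine in *; simpl fst in *; simpl snd in *.
    set (e1 := fst A - (fst B + t * (fst C - fst B))) in *.
    set (e2 := snd A - (snd B + t * (snd C - snd B))) in *.
    assert (e1 = 0 /\ e2 = 0) as [E1 E2] by (apply sum_sq_eq0; assumption).
    transitivity (e2 * (fst C - fst B) - e1 * (snd C - snd B)).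
    - unfold e1, e2; ring.
    - rewrite E1, E2; ring. }
  pose proof (distance_sq A B) as Sc. pose proof (distance_sq A C) as Sb.
  pose proof (distance_sq B C) as Sa.
  (* Strict Cauchy-Schwarz: the angle at A is not 0, so this factor can be cancelled from the angle
     equation below. *)
  assert (Hdelta : 0 < distance A B * distance A C - dot (vec A B) (vec A C)).
  { assert (Hsq : (distance A B * distance A C) ^ 2 - dot (vec A B) (vec A C) ^ 2
        = cross (vec A B) (vec A C) ^ 2).
    { rewrite Rpow_mult_distr, Sc, Sb. unfold dot, cross, vec; simpl fst; simpl snd. ring. }
    assert (0 < cross (vec A B) (vec A C) ^ 2) 
      by (rewrite <- Rsqr_pow2; apply Rsqr_pos_lt; exact Hcr).
    assert (0 < distance A B * distance A C) by nra. nra. }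
  set (b := distance A C) in *. set (c := distance A B) in *.
  assert (Hang : forall t, angle B A (affine B C t) = angle (affine B C t) A C
                 <-> t = c / (b + c)).
  { intros t. rewrite bisector_angle_iff by auto. fold b c.
    assert (E : dot (vec A B) (vec A (affine B C t)) * b
       - dot (vec A (affine B C t)) (vec A C) * c
       = (c * b - dot (vec A B) (vec A C)) * (c - t * (b + c))).
    { transitivity (((1 - t) * c ^ 2 + t * dot (vec A B) (vec A C)) * b
          - ((1 - t) * dot (vec A B) (vec A C) + t * b ^ 2) * c).
      - rewrite Sc, Sb. unfold dot, vec, affine; simpl fst; simpl snd. ring.
      - ring. }
    split; intros H.
    - apply Rminus_diag_eq in H. rewrite E in H.
      apply Rmult_integral in H. destruct H as [H|H]; [lra|].
      apply Rmult_eq_reg_r with (b + c); [|lra]. field_simplify; lra.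
    - apply Rminus_diag_uniq. rewrite E, H. field. lra. }
  assert (Hlen : distance A (affine B C (c / (b + c))) ^ 2 * (b + c) ^ 2
                 = b * c * ((b + c) ^ 2 - distance B C ^ 2)).
  { set (t := c / (b + c)).
    assert (Et : t * (b + c) = c) by (unfold t; field; lra).
    assert (Ed : distance A (affine B C t) ^ 2 =
       (1 - t) * c ^ 2 + t * b ^ 2 - t * (1 - t) * distance B C ^ 2).
    { rewrite Sc, Sb, Sa, distance_sq. unfold affine; simpl fst; simpl snd. ring. }
    rewrite Ed. unfold t. field. lra. }
  split.
  - intros (D & (t & Ht & ->) & HA & <-). split; [apply distance_ge0|].
    apply Hang in HA. subst t. exact Hlen.
  - intros [Hl El]. exists (affine B C (c / (b + c))). repeat split.
    + exists (c / (b + c)). repeat split; auto.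
      * apply Rlt_le, Rdiv_lt_0_compat; lra.
      * apply Rmult_le_reg_r with (b + c); [lra|]. field_simplify; lra.
    + apply Hang; reflexivity.
    + apply pow2_inj; auto; [apply distance_ge0|].
      apply Rmult_eq_reg_r with ((b + c) ^ 2); [lra|]. apply pow_nonzero; lra.
Qed.

(** Heron's formula: both sides of the equation are 16 times the squared area. *)
Lemma altitude_length_iff A B C h : cross (vec A B) (vec A C) <> 0 ->
  altitude_length B C A h <->
  0 <= h /\
  4 * h ^ 2 * distance C A ^ 2 =
  4 * distance A B ^ 2 * distance C A ^ 2
    - (distance A B ^ 2 + distance C A ^ 2 - distance B C ^ 2) ^ 2.
Proof.
  intros Hcr.
  assert (Hb : 0 < distance C A).
  { apply distance_pos. intros E. apply Hcr. unfold cross, vec; simpl fst; simpl snd.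
    assert (fst C - fst A = 0 /\ snd C - snd A = 0) as [] by (apply sum_sq_eq0; assumption).
    replace (fst C) with (fst A) by lra. replace (snd C) with (snd A) by lra. ring. }
  pose proof (distance_sq A B) as Sc. pose proof (distance_sq C A) as Sb.
  pose proof (distance_sq B C) as Sa.
  set (b := distance C A) in *.
  (* Parameter of the orthogonal projection of B on the line CA. *)
  set (t0 := dot (vec C B) (vec C A) / b ^ 2).
  assert (Hb2 : b ^ 2 <> 0) by (apply pow_nonzero; lra).
  assert (Hfoot : forall t, dot (vec B (affine C A t)) (vec C A) = (t - t0) * b ^ 2).
  { intros t. transitivity (t * b ^ 2 - dot (vec C B) (vec C A)).
    - rewrite Sb. unfold dot, vec, affine; simpl fst; simpl snd. ring.
    - unfold t0. field. lra. }
  assert (Hlen : 4 * distance B (affine C A t0) ^ 2 * b ^ 2 =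
    4 * distance A B ^ 2 * b ^ 2 - (distance A B ^ 2 + b ^ 2 - distance B C ^ 2) ^ 2).
  { assert (Et : t0 * b ^ 2 = dot (vec C B) (vec C A)) by (unfold t0; field; lra).
    assert (Ed : distance B (affine C A t0) ^ 2 =
       (1 - t0) * distance B C ^ 2 + t0 * distance A B ^ 2 - t0 * (1 - t0) * b ^ 2).
    { rewrite Sc, Sb, Sa, distance_sq. unfold affine; simpl fst; simpl snd. ring. }
    assert (E0 : t0 = (distance B C ^ 2 + b ^ 2 - distance A B ^ 2) / (2 * b ^ 2)).
    { unfold t0. apply Rmult_eq_reg_r with (2 * b ^ 2); [|lra].
      transitivity (2 * dot (vec C B) (vec C A)); [field; lra|].
      transitivity (distance B C ^ 2 + b ^ 2 - distance A B ^ 2); [|field; lra].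
      rewrite Sc, Sb, Sa. unfold dot, vec; simpl fst; simpl snd; ring. }
    rewrite Ed, E0. field. lra. }
  split.
  - intros (H & (t & ->) & Hp & <-). split; [apply distance_ge0|].
    rewrite Hfoot in Hp. apply Rmult_integral in Hp. destruct Hp as [Hp|Hp]; [|contradiction].
    replace t with t0 by lra. exact Hlen.
  - intros [Hh Eh]. exists (affine C A t0). repeat split.
    + exists t0; reflexivity.
    + rewrite Hfoot. ring.
    + apply pow2_inj; auto; [apply distance_ge0|].
      apply Rmult_eq_reg_r with (4 * b ^ 2); [|lra]. lra.
Qed.

(** When [cross] vanishes, a common line must be exhibited even if vertices coincide, hence three
    cases. *)
Lemma noncollinear_iff A B C :
  ~ collinear A B C <-> cross (vec A B) (vec A C) <> 0.
Proof.
  split.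
  - intros Hn E. apply Hn. destruct A as [a1 a2], B as [b1 b2], C as [c1 c2].
    unfold cross, vec in E; simpl in E.
    destruct (Req_dec ((b1 - a1) ^ 2 + (b2 - a2) ^ 2) 0) as [Z|NZ].
    + assert (b1 - a1 = 0 /\ b2 - a2 = 0) as [] by (apply sum_sq_eq0; assumption).
      assert (b1 = a1) by lra. assert (b2 = a2) by lra. subst.
      destruct (Req_dec ((c1 - a1) ^ 2 + (c2 - a2) ^ 2) 0) as [Z'|NZ'].
      * assert (c1 - a1 = 0 /\ c2 - a2 = 0) as [] by (apply sum_sq_eq0; assumption).
        assert (c1 = a1) by lra. assert (c2 = a2) by lra. subst.
        exists (a1, a2), (a1 + 1, a2). split.
        { intros E'. injection E'. lra. }
        repeat split; exists 0; unfold affine; simpl; f_equal; ring.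
      * exists (a1, a2), (c1, c2). split.
        { intros E'. injection E' as E1 E2. subst. apply NZ'. ring. }
        repeat split; [exists 0|exists 0|exists 1]; unfold affine; simpl; f_equal; ring.
    + exists (a1, a2), (b1, b2). split.
      { intros E'. injection E' as E1 E2. subst. apply NZ. ring. }
      repeat split; [exists 0|exists 1|]; try (unfold affine; simpl; f_equal; ring).
      (* Projection of C on the line AB; C differs from it by a multiple of [e], which is 0. *)
      exists (((c1 - a1) * (b1 - a1) + (c2 - a2) * (b2 - a2))
               / ((b1 - a1) ^ 2 + (b2 - a2) ^ 2)).
      set (e := (b1 - a1) * (c2 - a2) - (b2 - a2) * (c1 - a1)) in E.
      set (n := (b1 - a1) ^ 2 + (b2 - a2) ^ 2) in *.
      unfold affine; simpl fst; simpl snd. f_equal.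
      * transitivity (c1 + e * (b2 - a2) / n);
          [rewrite E; field; auto | unfold e, n in *; field; auto].
      * transitivity (c2 - e * (b1 - a1) / n);
          [rewrite E; field; auto | unfold e, n in *; field; auto].
  - intros Hcr (P & Q & _ & [s ->] & [t ->] & [u ->]). apply Hcr.
    unfold cross, vec, affine; simpl. ring.
Qed.

(* The affine map sending [vA S], [vB S], [vC S] to the vertices of [T] is an
   isometry, since both frames have the same Gram matrix. *)
Lemma congruent_iff S T :
  congruent S T <->
  distance (vB S) (vC S) = distance (vB T) (vC T) /\
  distance (vC S) (vA S) = distance (vC T) (vA T) /\
  distance (vA S) (vB S) = distance (vA T) (vB T).
Proof.
  destruct S as [A B C HS], T as [A' B' C' HT]; unfold congruent; simpl.
  split.
  - intros (f & Hf & <- & <- & <-). rewrite !Hf. auto.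
  - intros (Ea & Eb & Ec). apply noncollinear_iff in HS. clear HT.
    assert (Fa := distance_sq B C). assert (Fb := distance_sq C A).
    assert (Fc := distance_sq A B). rewrite Ea, distance_sq in Fa.
    rewrite Eb, distance_sq in Fb. rewrite Ec, distance_sq in Fc. clear Ea Eb Ec.
    destruct A as [a1 a2], B as [b1 b2], C as [c1 c2],
      A' as [a1' a2'], B' as [b1' b2'], C' as [c1' c2'].
    unfold cross, vec in HS; simpl fst in *; simpl snd in *.
    set (k := (b1 - a1) * (c2 - a2) - (b2 - a2) * (c1 - a1)) in *.
    (* Affine coordinates of X in the frame A, B, C, by Cramer's rule. *)
    set (s := fun X : point =>
      ((fst X - a1) * (c2 - a2) - (snd X - a2) * (c1 - a1)) / k).
    set (t := fun X : point =>
      ((b1 - a1) * (snd X - a2) - (b2 - a2) * (fst X - a1)) / k).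
    exists (fun X => (a1' + s X * (b1' - a1') + t X * (c1' - a1'),
                      a2' + s X * (b2' - a2') + t X * (c2' - a2'))).
    split; [|repeat split; unfold s, t, k in *; simpl; f_equal; field; auto].
    intros P Q. apply pow2_inj; try apply distance_ge0.
    rewrite !distance_sq; simpl fst; simpl snd.
    set (ds := s P - s Q). set (dt := t P - t Q).
    assert (E1 : fst P - fst Q = ds * (b1 - a1) + dt * (c1 - a1))
      by (unfold ds, dt, s, t, k in *; field; auto).
    assert (E2 : snd P - snd Q = ds * (b2 - a2) + dt * (c2 - a2))
      by (unfold ds, dt, s, t, k in *; field; auto).
    rewrite E1, E2.
    transitivity (ds * (ds + dt) * ((a1' - b1') ^ 2 + (a2' - b2') ^ 2)
      + dt * (ds + dt) * ((c1' - a1') ^ 2 + (c2' - a2') ^ 2)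
      - ds * dt * ((b1' - c1') ^ 2 + (b2' - c2') ^ 2)).
    + unfold ds, dt; ring.
    + rewrite Fa, Fb, Fc. ring.
Qed.

(** * Half-angle tangents *)

(* [r] is the inradius, [p] and [q] are the tangents of half the angles at [A]
   and [B]; the angle at [C] being positive amounts to [p * q < 1]. *)
Definition shape (T : labelled_triangle) (r p q : R) : Prop :=
  (0 < r /\ 0 < p /\ 0 < q /\ p * q < 1) /\
  distance (vB T) (vC T) = r * (1 + q ^ 2) / (q * (1 - p * q)) /\
  distance (vC T) (vA T) = r * (1 + p ^ 2) / (p * (1 - p * q)) /\
  distance (vA T) (vB T) = r * (p + q) / (p * q).

(** Ravi substitution: u, v, w are the tangent lengths from A, B, C to the incircle, so that r^2 = u
    v w / (u + v + w), p = r / u and q = r / v. *)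
Lemma triangle_shape T : exists r p q, shape T r p q.
Proof.
  destruct T as [A B C HT]; unfold shape; simpl.
  apply noncollinear_iff in HT.
  pose proof (distance_sq B C) as Fa. pose proof (distance_sq C A) as Fb.
  pose proof (distance_sq A B) as Fc.
  pose proof (distance_ge0 B C) as Ha. pose proof (distance_ge0 C A) as Hb.
  pose proof (distance_ge0 A B) as Hc.
  set (a := distance B C) in *. set (b := distance C A) in *.
  set (c := distance A B) in *.
  set (d := dot (vec A B) (vec A C)).
  assert (Ed : a ^ 2 = b ^ 2 + c ^ 2 - 2 * d).
  { rewrite Fa, Fb, Fc. unfold d, dot, vec; simpl fst; simpl snd. ring. }
  (* Positivity of both factors gives (b - c)^2 < a^2 < (b + c)^2, the strict triangle
     inequalities. *)
  assert (Hd : 0 < (b * c - d) * (b * c + d)).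
  { replace ((b * c - d) * (b * c + d)) with (cross (vec A B) (vec A C) ^ 2).
    - rewrite <- Rsqr_pow2; apply Rsqr_pos_lt; exact HT.
    - transitivity (b ^ 2 * c ^ 2 - d ^ 2); [|ring].
      rewrite Fb, Fc. unfold d, cross, dot, vec; simpl fst; simpl snd. ring. }
  assert (0 <= b * c) by nra.
  assert (H1 : 0 < b * c - d) by nra. assert (H2 : 0 < b * c + d) by nra.
  clearbody a b c d. clear A B C HT Fa Fb Fc.
  set (u := (b + c - a) / 2). set (v := (a + c - b) / 2). set (w := (a + b - c) / 2).
  assert (Hu : 0 < u) by (unfold u; nra).
  assert (Hv : 0 < v) by (unfold v; nra).
  assert (Hw : 0 < w) by (unfold w; nra).
  replace a with (v + w) by (unfold v, w; field).
  replace b with (u + w) by (unfold u, w; field).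
  replace c with (u + v) by (unfold u, v; field).
  clearbody u v w. clear - Hu Hv Hw.
  assert (Hr0 : 0 < u * v * w / (u + v + w)).
  { apply Rdiv_lt_0_compat; [|lra]. repeat apply Rmult_lt_0_compat; auto. }
  set (r := sqrt (u * v * w / (u + v + w))).
  assert (Hr : 0 < r) by (apply sqrt_lt_R0; exact Hr0).
  assert (Er : r ^ 2 = u * v * w / (u + v + w)) by (apply pow2_sqrt; lra).
  clearbody r.
  assert (Epq : 1 - r / u * (r / v) = (u + v) / (u + v + w)).
  { transitivity (1 - r ^ 2 / (u * v)); [field; lra|]. rewrite Er. field. lra. }
  assert (Hpq : 0 < (u + v) / (u + v + w)) by (apply Rdiv_lt_0_compat; lra).
  exists r, (r / u), (r / v).
  repeat split; try (apply Rdiv_lt_0_compat; lra); auto; try lra; try rewrite Epq.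
  - transitivity (v * (1 + r ^ 2 / v ^ 2) * (u + v + w) / (u + v));
      [rewrite Er|]; field; lra.
  - transitivity (u * (1 + r ^ 2 / u ^ 2) * (u + v + w) / (u + v));
      [rewrite Er|]; field; lra.
  - field; lra.
Qed.

Lemma shape_realized r p q : 0 < r -> 0 < p -> 0 < q -> p * q < 1 ->
  exists T, shape T r p q.
Proof.
  intros Hr Hp Hq Hpq.
  set (c := r * (p + q) / (p * q)).
  (* A is the origin, B lies on the first axis, and C is b (cos A, sin A) written rationally in [p],
     [q], [r]. *)
  set (A := (0, 0) : point). set (B := (c, 0) : point).
  set (C := (r * (1 - p ^ 2) / (p * (1 - p * q)), 2 * r / (1 - p * q)) : point).
  assert (Hc : 0 < c) by (apply Rdiv_lt_0_compat; nra).
  assert (HT : ~ collinear A B C).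
  { apply noncollinear_iff. unfold cross, vec; simpl.
    assert (0 < 2 * r / (1 - p * q)) by (apply Rdiv_lt_0_compat; lra). nra. }
  exists (Triangle A B C HT). unfold shape; simpl.
  repeat split; auto; apply pow2_inj; try apply distance_ge0; try rewrite distance_sq;
    simpl fst; simpl snd; try (unfold c; field; lra); try lra;
    apply Rlt_le, Rdiv_lt_0_compat; nra.
Qed.

Lemma shape_congruent S T r p q : shape S r p q -> shape T r p q -> congruent S T.
Proof.
  intros (_ & Sa & Sb & Sc) (_ & Ta & Tb & Tc). apply congruent_iff.
  rewrite Sa, Sb, Sc, Ta, Tb, Tc. auto.
Qed.

(** The half-angle formula for tan^2 (A/2). It recovers [p] from the sides, which is how
    non-congruent triangles are told apart later. *)
Lemma half_angle_tan r p q : 0 < r -> 0 < p -> 0 < q -> p * q < 1 ->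
  let a := r * (1 + q ^ 2) / (q * (1 - p * q)) in
  let b := r * (1 + p ^ 2) / (p * (1 - p * q)) in
  let c := r * (p + q) / (p * q) in
  0 < (b + c) ^ 2 - a ^ 2 /\ p ^ 2 * ((b + c) ^ 2 - a ^ 2) = a ^ 2 - (b - c) ^ 2.
Proof.
  intros Hr Hp Hq Hpq a b c. split; [|unfold a, b, c; field; lra].
  replace (_ - _) with (4 * r ^ 2 * (p + q) / (p ^ 2 * q * (1 - p * q)))
    by (unfold a, b, c; field; lra).
  assert (0 < p ^ 2) by nra. assert (0 < r ^ 2) by nra.
  apply Rdiv_lt_0_compat; repeat apply Rmult_lt_0_compat; lra.
Qed.

Lemma shape_half_angle_tan T r p q : shape T r p q ->
  let a := distance (vB T) (vC T) in
  let b := distance (vC T) (vA T) in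
  let c := distance (vA T) (vB T) in
  (0 < (b + c) ^ 2 - a ^ 2 /\ p ^ 2 * ((b + c) ^ 2 - a ^ 2) = a ^ 2 - (b - c) ^ 2) /\
  (0 < (a + c) ^ 2 - b ^ 2 /\ q ^ 2 * ((a + c) ^ 2 - b ^ 2) = b ^ 2 - (a - c) ^ 2).
Proof.
  intros ((Hr & Hp & Hq & Hpq) & -> & -> & ->). split.
  - apply half_angle_tan; auto.
  - rewrite (Rplus_comm p q), (Rmult_comm p q) in *. apply half_angle_tan; auto.
Qed.

Lemma congruent_shape_tan S T r p q r' p' q' :
  shape S r p q -> shape T r' p' q' -> congruent S T -> p = p' /\ q = q'.
Proof.
  intros HS HT (Ea & Eb & Ec)%congruent_iff.
  destruct (shape_half_angle_tan _ _ _ _ HS) as [[P1 P2] [Q1 Q2]].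
  destruct (shape_half_angle_tan _ _ _ _ HT) as [[P1' P2'] [Q1' Q2']].
  rewrite <- Ea, <- Eb, <- Ec in *.
  destruct HS as ((Hr & Hp & Hq & Hpq) & _), HT as ((Hr' & Hp' & Hq' & Hpq') & _).
  rewrite <- P2' in P2. rewrite <- Q2' in Q2.
  apply Rmult_eq_reg_r in P2; [|lra]. apply Rmult_eq_reg_r in Q2; [|lra].
  split; apply pow2_inj; lra.
Qed.

Lemma triangle_cross T : cross (vec (vA T) (vB T)) (vec (vA T) (vC T)) <> 0.
Proof. apply noncollinear_iff, nondegenerate. Qed.

(** This is h_b = c sin A with sin A = 2 p / (1 + p^2). *)
Lemma shape_has_hb T r p q x : shape T r p q ->
  has_hb T x <-> x = 2 * r * (p + q) / (q * (1 + p ^ 2)).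
Proof.
  intros ((Hr & Hp & Hq & Hpq) & Ea & Eb & Ec).
  unfold has_hb. rewrite altitude_length_iff by apply triangle_cross.
  rewrite Ea, Eb, Ec.
  assert (Hx : 0 < 2 * r * (p + q) / (q * (1 + p ^ 2))) by (apply Rdiv_lt_0_compat; nra).
  assert (Hb : 0 < 4 * (r * (1 + p ^ 2) / (p * (1 - p * q))) ^ 2).
  { apply Rmult_lt_0_compat; [lra|]. apply pow_lt, Rdiv_lt_0_compat; nra. }
  split.
  - intros [H0 E]. apply pow2_inj; try lra.
    eapply Rmult_eq_reg_r; [|apply Rgt_not_eq; exact Hb].
    transitivity (4 * x ^ 2 * (r * (1 + p ^ 2) / (p * (1 - p * q))) ^ 2); [ring|].
    rewrite E. field. repeat split; nra.
  - intros ->. split; [lra|]. field. repeat split; nra.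
Qed.

(** In the triangle ABD, with D the foot, l_a = c sin B / sin (B + A/2); [2 * q + p - q ^ 2 * p] is
    this last sine up to a positive factor. *)
Lemma shape_has_la T r p q l : shape T r p q ->
  has_la T l <->
  l = 2 * r * (p + q) * sqrt (1 + p ^ 2) / (p * (2 * q + p - q ^ 2 * p)).
Proof.
  intros ((Hr & Hp & Hq & Hpq) & Ea & Eb & Ec).
  unfold has_la. rewrite bisector_length_iff by apply triangle_cross.
  rewrite (distance_sym (vA T) (vC T)), Ea, Eb, Ec.
  assert (Hsp : 0 < 1 + p ^ 2) by nra.
  assert (Hg : 0 < sqrt (1 + p ^ 2)) by (apply sqrt_lt_R0; lra).
  assert (Eg : sqrt (1 + p ^ 2) ^ 2 = 1 + p ^ 2) by (apply pow2_sqrt; lra).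
  set (g := sqrt (1 + p ^ 2)) in *. clearbody g.
  assert (Hm : 0 < 2 * q + p - q ^ 2 * p) by nra.
  assert (Hl : 0 < 2 * r * (p + q) * g / (p * (2 * q + p - q ^ 2 * p))).
  { apply Rdiv_lt_0_compat; repeat apply Rmult_lt_0_compat; lra. }
  set (s := r * (1 + p ^ 2) / (p * (1 - p * q)) + r * (p + q) / (p * q)).
  assert (Hs : 0 < s).
  { apply Rplus_lt_0_compat; apply Rdiv_lt_0_compat; repeat apply Rmult_lt_0_compat; lra. }
  assert (El : (2 * r * (p + q) * g / (p * (2 * q + p - q ^ 2 * p))) ^ 2 * s ^ 2 =
    r * (1 + p ^ 2) / (p * (1 - p * q)) * (r * (p + q) / (p * q)) *
     (s ^ 2 - (r * (1 + q ^ 2) / (q * (1 - p * q))) ^ 2)).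
  { transitivity (g ^ 2 * (2 * r * (p + q) / (p * (2 * q + p - q ^ 2 * p))) ^ 2 * s ^ 2).
    - field. lra.
    - rewrite Eg. unfold s. field. repeat split; lra. }
  split.
  - intros [H0 E]. apply pow2_inj; try lra.
    apply Rmult_eq_reg_r with (s ^ 2); [|apply pow_nonzero; lra]. lra.
  - intros ->. split; [lra|]. exact El.
Qed.

(** Exchanging the labels A and B turns l_b into l_a. *)
Lemma shape_has_lb T r p q l : shape T r p q ->
  Defs.has_lb T l <->
  l = 2 * r * (p + q) * sqrt (1 + q ^ 2) / (q * (2 * p + q - p ^ 2 * q)).
Proof.
  intros ((Hr & Hp & Hq & Hpq) & Ea & Eb & Ec).
  assert (HC : cross (vec (vB T) (vC T)) (vec (vB T) (vA T)) <> 0).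
  { intros E. apply (triangle_cross T). rewrite <- E. unfold cross, vec; simpl; ring. }
  assert (HT' : ~ collinear (vB T) (vA T) (vC T)).
  { apply noncollinear_iff. intros E. apply HC.
    transitivity (- cross (vec (vB T) (vA T)) (vec (vB T) (vC T))); [|lra].
    unfold cross, vec; simpl; ring. }
  rewrite (Rplus_comm p q).
  rewrite <- (shape_has_la (Triangle (vB T) (vA T) (vC T) HT') r q p).
  - unfold has_la, Defs.has_lb; simpl. rewrite !bisector_length_iff; auto.
    + rewrite (distance_sym (vA T) (vC T)), (Rplus_comm (distance (vB T) (vA T))),
        (Rmult_comm (distance (vB T) (vA T))). reflexivity.
    + apply (triangle_cross (Triangle _ _ _ HT')).
  - unfold shape; simpl. rewrite (distance_sym (vA T) (vC T)),
      (distance_sym (vC T) (vB T)), (distance_sym (vB T) (vA T)), Ea, Eb, Ec.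
    repeat split; auto; try lra; f_equal; try ring; f_equal; f_equal; ring.
Qed.

(** * The ratio of the altitude to the bisector from A *)

(* With [p] = tan (A/2) and [k] = cot (A + B/2), tan (B/2) is [num k p / den k p]
   and sin (B + A/2) is proportional to [cub k p]; [ratio_sq k p] is (h_b / l_a)^2. *)
Definition num (k p : R) : R := 1 - p ^ 2 - 2 * k * p.
Definition den (k p : R) : R := 2 * p + k - k * p ^ 2.
Definition cub (k p : R) : R :=
  2 * k + 3 * (1 - k ^ 2) * p - 6 * k * p ^ 2 - (1 - k ^ 2) * p ^ 3.

Definition ratio_sq (k p : R) : R :=
  p ^ 2 * cub k p ^ 2 / ((1 + p ^ 2) * num k p ^ 2 * den k p ^ 2).

(** In terms of angles, [0 <= p + k] means A + B <= pi, [0 < num k p] means B > 0, and [den] is a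
    positive multiple of cos (B/2). The weak inequality admits the degenerate end [p = - k]. *)
Lemma den_pos k p : 0 < p -> 0 <= p + k -> 0 < num k p -> 0 < den k p.
Proof.
  unfold num, den. intros Hp Hpk HN. destruct (Rle_lt_dec 0 k).
  - assert (0 <= k * p) by nra.
    replace (2 * p + k - k * p ^ 2) with ((1 - p ^ 2) * (p + k) + p + p ^ 3) by ring.
    assert (0 <= (1 - p ^ 2) * (p + k)) by (apply Rmult_le_pos; lra).
    assert (0 < p ^ 3) by (apply pow_lt; lra). lra.
  - assert (0 <= - k * p ^ 2) by (apply Rmult_le_pos; [lra | apply pow2_ge_0]). nra.
Qed.

(** Up to a common factor this is sin B + sin (A + B) = 2 sin (B + A/2) cos (A/2); it makes the sign
    of [cub] visible. *)
Lemma cub_split k p :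
  cub k p = den k p * num k p + (1 + p ^ 2) * ((1 - k * p) * (p + k)).
Proof. unfold cub, den, num. ring. Qed.

Lemma cub_pos k p : 0 < p -> 0 <= p + k -> 0 < num k p -> 0 < cub k p.
Proof.
  intros Hp Hpk HN. rewrite cub_split.
  pose proof (den_pos k p Hp Hpk HN).
  assert (0 <= 1 - k * p) by (unfold num in HN; nra).
  assert (0 < den k p * num k p) by (apply Rmult_lt_0_compat; assumption).
  assert (0 <= (1 + p ^ 2) * ((1 - k * p) * (p + k))).
  { apply Rmult_le_pos; [nra|]. apply Rmult_le_pos; lra. }
  lra.
Qed.

(* [cot_b k p] is cot B, and [deriv_factor k p] is, up to a positive factor,
   2 cot A - 3 cot (B + A/2) + 4 cot B. *)
Definition cot_b (k p : R) : R := (den k p ^ 2 - num k p ^ 2) / (2 * num k p * den k p).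

Definition deriv_factor (k p : R) : R :=
  let y := cot_b k p in 1 + 2 * y * p + 4 * y ^ 2 * p ^ 2 - y * p ^ 3 + 2 * p ^ 2.

(* The bound on [z] below is cot A + cot B > 0. *)
Lemma deriv_factor_pos k p : 0 < p -> 0 < p + k -> 0 < num k p -> 0 < deriv_factor k p.
Proof.
  intros Hp Hpk HN. pose proof (den_pos k p Hp (Rlt_le _ _ Hpk) HN) as HD.
  assert (Hz : p ^ 2 - 1 < 2 * cot_b k p * p).
  { assert (E : 2 * cot_b k p * p - (p ^ 2 - 1)
      = (num k p + p * den k p) * (den k p - p * num k p) / (num k p * den k p))
      by (unfold cot_b; field; lra).
    assert (Hdn : den k p - p * num k p = (1 + p ^ 2) * (p + k))
      by (unfold den, num; ring).
    assert (0 < (num k p + p * den k p) * (den k p - p * num k p) / (num k p * den k p)).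
    { rewrite Hdn. apply Rdiv_lt_0_compat; [|nra].
      apply Rmult_lt_0_compat; nra. }
    lra. }
  unfold deriv_factor. cbv zeta. set (y := cot_b k p) in *. set (z := 2 * y * p) in *.
  replace (1 + z + 4 * y ^ 2 * p ^ 2 - y * p ^ 3 + 2 * p ^ 2)
    with (1 + z + z ^ 2 - z * p ^ 2 / 2 + 2 * p ^ 2) by (unfold z; field).
  clearbody z. assert (0 < p ^ 2) by nra. destruct (Rle_lt_dec 0 z); nra.
Qed.

Lemma ratio_sq_derive k p : 0 < p -> 0 <= p + k -> 0 < num k p ->
  is_derive (ratio_sq k) p
    (4 * p * cub k p * deriv_factor k p / ((1 + p ^ 2) ^ 3 * num k p * den k p)).
Proof.
  intros Hp Hpk HN. pose proof (den_pos k p Hp Hpk HN) as HD.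
  unfold ratio_sq, deriv_factor, cot_b. unfold num, den, cub in *.
  auto_derive.
  - repeat apply Rmult_integral_contrapositive_currified; nra.
  - field. repeat split; nra.
Qed.

(** For [k >= 0], [num k] decreases; for [k < 0] it is the quotient [num k p / p] = 1/p - p - 2k
    whose decrease is used. *)
Lemma num_pos_between k a b p : 0 < a -> a <= p <= b -> 0 < num k b -> 0 < num k p.
Proof.
  unfold num. intros Ha Hab Hb. destruct (Rle_lt_dec 0 k).
  - assert (0 <= k * (b - p)) by (apply Rmult_le_pos; lra). nra.
  - assert (b * (1 - p ^ 2 - 2 * k * p) =
      p * (1 - b ^ 2 - 2 * k * b) + (b - p) * (1 + b * p)) by ring.
    assert (0 < p * (1 - b ^ 2 - 2 * k * b)) by (apply Rmult_lt_0_compat; lra).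
    assert (0 <= (b - p) * (1 + b * p)) by (apply Rmult_le_pos; nra).
    nra.
Qed.

(** Mean value theorem: only the open interval needs a positive derivative, so [a] may be the
    degenerate end [- k]. *)
Lemma ratio_sq_increasing k a b : 0 < a -> 0 <= a + k -> a < b -> 0 < num k b ->
  ratio_sq k a < ratio_sq k b.
Proof.
  intros Ha Hak Hab Hb.
  destruct (MVT_cor2 (ratio_sq k)
    (fun p => 4 * p * cub k p * deriv_factor k p / ((1 + p ^ 2) ^ 3 * num k p * den k p))
    a b Hab) as (c & E & Hc).
  - intros c Hc. apply is_derive_Reals, ratio_sq_derive; try lra.
    apply num_pos_between with a b; auto.
  - assert (HN : 0 < num k c) by (apply num_pos_between with a b; auto; lra).
    assert (0 < den k c) by (apply den_pos; lra).
    assert (0 < cub k c) by (apply cub_pos; lra).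
    assert (0 < deriv_factor k c) by (apply deriv_factor_pos; lra).
    assert (0 < 4 * c * cub k c * deriv_factor k c
              / ((1 + c ^ 2) ^ 3 * num k c * den k c) * (b - a)); [|lra].
    assert (0 < (1 + c ^ 2) ^ 3) by (apply pow_lt; nra).
    apply Rmult_lt_0_compat; [apply Rdiv_lt_0_compat|];
      repeat (assumption || apply Rmult_lt_0_compat); lra.
Qed.

(** * The equation (h_b / l_a)^2 = kappa2 for fixed k *)

Lemma IVT_pos_neg f a b : continuity f -> a < b -> 0 < f a -> f b < 0 ->
  exists z, a < z < b /\ f z = 0.
Proof.
  intros Hf Hab Ha Hb.
  destruct (IVT (- f)%F a b) as (z & Hz & E); unfold opp_fct in *; try lra.
  - apply continuity_opp, Hf.
  - exists z. assert (E' : f z = 0) by lra. split; auto.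
    destruct (Req_dec z a) as [->|]; [lra|]. destruct (Req_dec z b) as [->|]; lra.
Qed.

(** The right end of the range of [p], where B shrinks to 0: the tangent of half the angle whose
    cotangent is [k]. *)
Definition num_root (k : R) : R := sqrt (1 + k ^ 2) - k.

Lemma num_root_pos k : 0 < num_root k /\ 0 < num_root k + k.
Proof.
  unfold num_root.
  assert (E : sqrt (1 + k ^ 2) ^ 2 = 1 + k ^ 2) by (apply pow2_sqrt; nra).
  assert (0 < sqrt (1 + k ^ 2)) by (apply sqrt_lt_R0; nra). nra.
Qed.

Lemma num_at_root k : num k (num_root k) = 0.
Proof.
  unfold num, num_root.
  assert (E : sqrt (1 + k ^ 2) ^ 2 = 1 + k ^ 2) by (apply pow2_sqrt; nra). nra.
Qed.

Lemma num_pos_left k p : 0 < p < num_root k -> 0 < num k p.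
Proof.
  intros Hp. pose proof (num_root_pos k). pose proof (num_at_root k) as E.
  unfold num in *. set (b := num_root k) in *.
  (* By Vieta the second root is [- b - 2 * k]. *)
  replace (1 - p ^ 2 - 2 * k * p) with ((b - p) * (b + k + (p + k))) by nra.
  destruct (Rle_lt_dec 0 (p + k)); nra.
Qed.

(** The equation [ratio_sq k p = kappa2] cleared of denominators: a polynomial, hence still
    continuous at the root of [num k], where the ratio is infinite. *)
Definition gap (kappa2 k p : R) : R :=
  kappa2 * (1 + p ^ 2) * num k p ^ 2 * den k p ^ 2 - p ^ 2 * cub k p ^ 2.

Lemma gap_at_root kappa2 k : gap kappa2 k (num_root k) < 0.
Proof.
  pose proof (num_at_root k) as E. destruct (num_root_pos k) as [H1 H2].
  unfold gap. rewrite cub_split, E.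
  assert (E' : 1 - k * num_root k = (1 + num_root k ^ 2) / 2) by (unfold num in E; lra).
  rewrite E'. set (b := num_root k) in *.
  assert (0 < (b * ((1 + b ^ 2) * ((1 + b ^ 2) / 2 * (b + k)))) ^ 2).
  { apply pow_lt. repeat apply Rmult_lt_0_compat; nra. }
  nra.
Qed.

Lemma gap_continuity kappa2 k : continuity (gap kappa2 k).
Proof. unfold gap, num, den, cub. reg. Qed.

(** Intermediate values between the left end max (0, -k) and [num_root k]. For [k < 0] the sign at
    the left end is that of [kappa2 * (1 + k ^ 2) - k ^ 2], whence the second alternative. *)
Lemma gap_root_exists kappa2 k : 0 < kappa2 -> (0 <= k \/ k ^ 2 < kappa2 * (1 + k ^ 2)) ->
  exists p, 0 < p /\ 0 < p + k /\ 0 < num k p /\ gap kappa2 k p = 0.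
Proof.
  intros Hkappa Hk. destruct (Rtotal_order k 0) as [Hneg|[->|Hpos]].
  - assert (Hk2 : k ^ 2 < kappa2 * (1 + k ^ 2)) by (destruct Hk; [lra | auto]).
    destruct (IVT_pos_neg (gap kappa2 k) (- k) (num_root k)) as (z & Hz & E).
    + apply gap_continuity.
    + pose proof (num_root_pos k); lra.
    + replace (gap kappa2 k (- k))
        with (k ^ 2 * (1 + k ^ 2) ^ 4 * (kappa2 * (1 + k ^ 2) - k ^ 2))
        by (unfold gap, num, den, cub; ring).
      assert (0 < k ^ 2) by nra. assert (0 < (1 + k ^ 2) ^ 4) by (apply pow_lt; nra).
      repeat (assumption || apply Rmult_lt_0_compat); lra.
    + apply gap_at_root.
    + exists z. repeat split; auto; try lra. apply num_pos_left; lra.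
  - (* For [k = 0] the gap vanishes to second order at [p = 0]. *)
    destruct (IVT_pos_neg (fun p => 4 * kappa2 * (1 + p ^ 2) * (1 - p ^ 2) ^ 2
        - p ^ 2 * (3 - p ^ 2) ^ 2) 0 1) as (z & Hz & E); try lra.
    + reg.
    + exists z. repeat split; try lra.
      * unfold num. nra.
      * transitivity (z ^ 2 * (4 * kappa2 * (1 + z ^ 2) * (1 - z ^ 2) ^ 2
          - z ^ 2 * (3 - z ^ 2) ^ 2)); [unfold gap, num, den, cub; ring|].
        rewrite E. ring.
  - destruct (IVT_pos_neg (gap kappa2 k) 0 (num_root k)) as (z & Hz & E).
    + apply gap_continuity.
    + apply num_root_pos.
    + replace (gap kappa2 k 0) with (kappa2 * k ^ 2)
        by (unfold gap, num, den, cub; ring).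
      apply Rmult_lt_0_compat; nra.
    + apply gap_at_root.
    + exists z. repeat split; auto; try lra. apply num_pos_left; lra.
Qed.

Lemma gap_root_ratio kappa2 k p : 0 < p -> 0 < p + k -> 0 < num k p ->
  gap kappa2 k p = 0 -> ratio_sq k p = kappa2.
Proof.
  unfold gap, ratio_sq. intros Hp Hpk HN E.
  pose proof (den_pos k p Hp (Rlt_le _ _ Hpk) HN).
  replace (p ^ 2 * cub k p ^ 2) with (kappa2 * (1 + p ^ 2) * num k p ^ 2 * den k p ^ 2)
    by lra.
  field. repeat split; nra.
Qed.

Lemma gap_root_unique kappa2 k p p' :
  0 < p -> 0 < p + k -> 0 < num k p -> gap kappa2 k p = 0 ->
  0 < p' -> 0 < p' + k -> 0 < num k p' -> gap kappa2 k p' = 0 -> p = p'.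
Proof.
  intros H1 H2 H3 H4 H1' H2' H3' H4'.
  apply gap_root_ratio in H4; auto. apply gap_root_ratio in H4'; auto.
  destruct (Rtotal_order p p') as [Hl|[E|Hl]]; auto.
  - assert (ratio_sq k p < ratio_sq k p') by (apply ratio_sq_increasing; lra). lra.
  - assert (ratio_sq k p' < ratio_sq k p) by (apply ratio_sq_increasing; lra). lra.
Qed.

(** For [k < 0], monotonicity compares the root with the left end [p = - k], where the angle at C
    vanishes and the squared ratio is [k ^ 2 / (1 + k ^ 2)]. *)
Lemma gap_root_bound kappa2 k p :
  0 < p -> 0 < p + k -> 0 < num k p -> gap kappa2 k p = 0 ->
  0 <= k \/ k ^ 2 < kappa2 * (1 + k ^ 2).
Proof.
  intros H1 H2 H3 H4. apply gap_root_ratio in H4; auto.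
  destruct (Rle_lt_dec 0 k) as [|Hk]; auto. right.
  assert (Hi : ratio_sq k (- k) < ratio_sq k p) by (apply ratio_sq_increasing; lra).
  replace (ratio_sq k (- k)) with (k ^ 2 / (1 + k ^ 2)) in Hi
    by (unfold ratio_sq, num, den, cub; field; repeat split; nra).
  rewrite H4 in Hi. apply Rmult_lt_compat_r with (r := 1 + k ^ 2) in Hi; [|nra].
  unfold Rdiv in Hi. rewrite Rmult_assoc, Rinv_l in Hi; nra.
Qed.

(** * Counting triangles *)

Lemma eq_iff_sq x y : 0 <= x -> 0 <= y -> x = y <-> x ^ 2 = y ^ 2.
Proof. intros Hx Hy. split; [intros -> | apply pow2_inj]; auto. Qed.

(* The inradius is eliminated by the altitude; the equations left over are
   those for [l_b] and [l_a], in this order, squared. *)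
Lemma prescribed_iff l1 l2 x T r p q : 0 < l1 -> 0 < l2 -> 0 < x -> shape T r p q ->
  prescribed l1 l2 x T <->
  r = x * q * (1 + p ^ 2) / (2 * (p + q)) /\
  x ^ 2 * ((1 + p ^ 2) ^ 2 * (1 + q ^ 2)) = l1 ^ 2 * (2 * p + q - p ^ 2 * q) ^ 2 /\
  x ^ 2 * (1 + p ^ 2) ^ 3 * q ^ 2 = l2 ^ 2 * p ^ 2 * (2 * q + p - q ^ 2 * p) ^ 2.
Proof.
  intros Hl1 Hl2 Hx HT. unfold prescribed.
  rewrite (shape_has_la T r p q), (shape_has_lb T r p q), (shape_has_hb T r p q) by exact HT.
  destruct HT as ((Hr & Hp & Hq & Hpq) & _).
  assert (Hr_iff : x = 2 * r * (p + q) / (q * (1 + p ^ 2)) <->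
                   r = x * q * (1 + p ^ 2) / (2 * (p + q)))
    by (split; intros ->; field; repeat split; nra).
  assert (Hsp : 0 < 1 + p ^ 2) by nra. assert (Hsq : 0 < 1 + q ^ 2) by nra.
  assert (Ep : sqrt (1 + p ^ 2) ^ 2 = 1 + p ^ 2) by (apply pow2_sqrt; lra).
  assert (Eq : sqrt (1 + q ^ 2) ^ 2 = 1 + q ^ 2) by (apply pow2_sqrt; lra).
  assert (Hgp : 0 < sqrt (1 + p ^ 2)) by (apply sqrt_lt_R0; lra).
  assert (Hgq : 0 < sqrt (1 + q ^ 2)) by (apply sqrt_lt_R0; lra).
  set (g := sqrt (1 + p ^ 2)) in *. set (h := sqrt (1 + q ^ 2)) in *.
  assert (Hm : 0 < 2 * q + p - q ^ 2 * p) by nra.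
  assert (Hn : 0 < 2 * p + q - p ^ 2 * q) by nra.
  assert (Hb : r = x * q * (1 + p ^ 2) / (2 * (p + q)) ->
    l1 = 2 * r * (p + q) * h / (q * (2 * p + q - p ^ 2 * q)) <->
    x ^ 2 * ((1 + p ^ 2) ^ 2 * (1 + q ^ 2)) = l1 ^ 2 * (2 * p + q - p ^ 2 * q) ^ 2).
  { intros ->.
    replace (x ^ 2 * ((1 + p ^ 2) ^ 2 * (1 + q ^ 2))) with ((x * (1 + p ^ 2) * h) ^ 2)
      by (rewrite !Rpow_mult_distr, Eq; ring).
    rewrite <- Rpow_mult_distr, <- eq_iff_sq;
      [|apply Rlt_le; repeat (assumption || apply Rmult_lt_0_compat)
       |apply Rlt_le; repeat (assumption || apply Rmult_lt_0_compat)].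
    replace (2 * (x * q * (1 + p ^ 2) / (2 * (p + q))) * (p + q) * h
       / (q * (2 * p + q - p ^ 2 * q))) with (x * (1 + p ^ 2) * h / (2 * p + q - p ^ 2 * q))
      by (field; lra).
    split; [intros ->; field; lra | intros ->; field; lra]. }
  assert (Ha : r = x * q * (1 + p ^ 2) / (2 * (p + q)) ->
    l2 = 2 * r * (p + q) * g / (p * (2 * q + p - q ^ 2 * p)) <->
    x ^ 2 * (1 + p ^ 2) ^ 3 * q ^ 2 = l2 ^ 2 * p ^ 2 * (2 * q + p - q ^ 2 * p) ^ 2).
  { intros ->.
    replace (x ^ 2 * (1 + p ^ 2) ^ 3 * q ^ 2) with ((x * (1 + p ^ 2) * g * q) ^ 2)
      by (rewrite !Rpow_mult_distr, Ep; ring).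
    rewrite <- !Rpow_mult_distr, <- eq_iff_sq;
      [|apply Rlt_le; repeat (assumption || apply Rmult_lt_0_compat)
       |apply Rlt_le; repeat (assumption || apply Rmult_lt_0_compat)].
    replace (2 * (x * q * (1 + p ^ 2) / (2 * (p + q))) * (p + q) * g
       / (p * (2 * q + p - q ^ 2 * p)))
      with (x * (1 + p ^ 2) * g * q / (p * (2 * q + p - q ^ 2 * p)))
      by (field; lra).
    split; [intros ->; field; lra |].
    intros ->; field; lra. }
  tauto.
Qed.

(** For positive [x] and [l2]: h_b = [x] determines [r], l_a = [l2] is the [gap] equation, and cot
    (A + B/2) = [k] gives tan (B/2). Positivity of [p + k] and [num k p] is that of the angles at C
    and B. *)
Definition on_branch (l2 x k : R) (T : labelled_triangle) : Prop :=
  exists r p,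
    (0 < p /\ 0 < p + k /\ 0 < num k p) /\
    shape T r p (num k p / den k p) /\
    r = x * (num k p / den k p) * (1 + p ^ 2) / (2 * (p + num k p / den k p)) /\
    gap (x ^ 2 / l2 ^ 2) k p = 0.

Lemma gap_iff l2 x k p : 0 < l2 -> 0 < p -> 0 < p + k -> 0 < num k p ->
  let q := num k p / den k p in
  x ^ 2 * (1 + p ^ 2) ^ 3 * q ^ 2 = l2 ^ 2 * p ^ 2 * (2 * q + p - q ^ 2 * p) ^ 2 <->
  gap (x ^ 2 / l2 ^ 2) k p = 0.
Proof.
  intros Hl2 Hp Hpk HN q. pose proof (den_pos k p Hp (Rlt_le _ _ Hpk) HN) as HD.
  (* Both expressions are multiples of sin (B + A/2). *)
  assert (Em : 2 * q + p - q ^ 2 * p = (1 + p ^ 2) * cub k p / den k p ^ 2).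
  { replace ((1 + p ^ 2) * cub k p)
      with (2 * num k p * den k p + p * (den k p ^ 2 - num k p ^ 2))
      by (unfold cub, den, num; ring).
    unfold q. field. lra. }
  rewrite Em.
  set (f := l2 ^ 2 * (1 + p ^ 2) ^ 2 / den k p ^ 4).
  assert (Hf : f <> 0).
  { unfold f. apply Rgt_not_eq, Rdiv_lt_0_compat; [|apply pow_lt; lra].
    apply Rmult_lt_0_compat; apply pow_lt; nra. }
  assert (E : x ^ 2 * (1 + p ^ 2) ^ 3 * q ^ 2
     - l2 ^ 2 * p ^ 2 * ((1 + p ^ 2) * cub k p / den k p ^ 2) ^ 2
     = gap (x ^ 2 / l2 ^ 2) k p * f) by (unfold gap, f, q; field; lra).
  split; intros H.
  - apply Rminus_diag_eq in H. rewrite E in H.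
    apply Rmult_integral in H. tauto.
  - apply Rminus_diag_uniq. rewrite E, H. ring.
Qed.

Lemma branch_cot k p : 0 < p -> 0 < p + k -> 0 < num k p ->
  let q := num k p / den k p in
  0 < q /\ p * q < 1 /\
  1 - p ^ 2 - 2 * p * q = k * (2 * p + q - p ^ 2 * q).
Proof.
  intros Hp Hpk HN q. pose proof (den_pos k p Hp (Rlt_le _ _ Hpk) HN) as HD.
  repeat split.
  - apply Rdiv_lt_0_compat; auto.
  - assert (E : 1 - p * q = (1 + p ^ 2) * (p + k) / den k p)
      by (unfold q; unfold num, den in *; field; lra).
    assert (0 < (1 + p ^ 2) * (p + k) / den k p) by (apply Rdiv_lt_0_compat; nra).
    lra.
  - unfold q; unfold num, den in *; field; lra.
Qed.

(** Converse of [branch_cot]: for given [p], the addition formula for cot (A + B/2) makes [q] and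
    [k] determine each other. *)
Lemma cot_branch p q : 0 < p -> 0 < q -> p * q < 1 ->
  let k := (1 - p ^ 2 - 2 * p * q) / (2 * p + q - p ^ 2 * q) in
  0 < p + k /\ 0 < num k p /\ q = num k p / den k p.
Proof.
  intros Hp Hq Hpq k.
  assert (Hs : 0 < 2 * p + q - p ^ 2 * q) by nra.
  assert (Epk : p + k = (1 + p ^ 2) * (1 - p * q) / (2 * p + q - p ^ 2 * q))
    by (unfold k; field; lra).
  assert (EN : num k p = q * (1 + p ^ 2) ^ 2 / (2 * p + q - p ^ 2 * q))
    by (unfold num, k; field; lra).
  assert (ED : den k p = (1 + p ^ 2) ^ 2 / (2 * p + q - p ^ 2 * q))
    by (unfold den, k; field; lra).
  assert (0 < (1 + p ^ 2) ^ 2) by (apply pow_lt; nra).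
  repeat split.
  - rewrite Epk. apply Rdiv_lt_0_compat; nra.
  - rewrite EN. apply Rdiv_lt_0_compat; nra.
  - rewrite EN, ED. field. split; nra.
Qed.

Lemma prescribed_pos l1 l2 x T : prescribed l1 l2 x T -> 0 < x.
Proof.
  intros (_ & _ & Hh). destruct (triangle_shape T) as (r & p & q & HT).
  apply (shape_has_hb _ _ _ _ _ HT) in Hh.
  destruct HT as ((Hr & Hp & Hq & Hpq) & _). subst x.
  apply Rdiv_lt_0_compat; nra.
Qed.

Lemma prescribed_branch l1 l2 x T : 0 < l1 -> 0 < l2 -> 0 < x ->
  prescribed l1 l2 x T <->
  exists k, x ^ 2 * (1 + k ^ 2) = l1 ^ 2 /\ on_branch l2 x k T.
Proof.
  intros Hl1 Hl2 Hx.
  (* The equation for l_b is h_b = l_b sin (A + B/2), squared. Since 1 / sin^2 = 1 + cot^2, it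
     involves the angles through [k] alone. *)
  assert (Hk : forall p q k, 0 < p -> 0 < q -> p * q < 1 ->
     1 - p ^ 2 - 2 * p * q = k * (2 * p + q - p ^ 2 * q) ->
     x ^ 2 * ((1 + p ^ 2) ^ 2 * (1 + q ^ 2)) = l1 ^ 2 * (2 * p + q - p ^ 2 * q) ^ 2 <->
     x ^ 2 * (1 + k ^ 2) = l1 ^ 2).
  { intros p q k Hp Hq Hpq E.
    assert (Hs : 0 < 2 * p + q - p ^ 2 * q) by nra.
    assert (Hs2 : (2 * p + q - p ^ 2 * q) ^ 2 <> 0) by (apply pow_nonzero; lra).
    replace ((1 + p ^ 2) ^ 2 * (1 + q ^ 2)) with
      ((2 * p + q - p ^ 2 * q) ^ 2 + (1 - p ^ 2 - 2 * p * q) ^ 2) by ring.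
    rewrite E. split; intros H.
    - apply Rmult_eq_reg_r with ((2 * p + q - p ^ 2 * q) ^ 2); auto.
      rewrite <- H. ring.
    - rewrite <- H. ring. }
  split.
  - intros H. destruct (triangle_shape T) as (r & p & q & HT).
    apply (prescribed_iff _ _ _ _ r p q) in H; auto. destruct H as (Er & Eb & Ea).
    pose proof HT as ((Hr & Hp & Hq & Hpq) & _).
    destruct (cot_branch p q Hp Hq Hpq) as (Hpk & HN & Eq).
    set (k := (1 - p ^ 2 - 2 * p * q) / (2 * p + q - p ^ 2 * q)) in *.
    exists k. split.
    + apply (Hk p q k); auto. unfold k. field. nra.
    + exists r, p. rewrite <- Eq. repeat split; auto; try apply HT.
      apply gap_iff; auto. rewrite <- Eq. exact Ea.
  - intros (k & Ek & r & p & (Hp & Hpk & HN) & HT & Er & Eg).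
    destruct (branch_cot k p Hp Hpk HN) as (Hq & Hpq & Ec).
    apply (prescribed_iff _ _ _ _ _ _ _ Hl1 Hl2 Hx HT). repeat split; auto.
    + apply (Hk _ _ k); auto.
    + apply gap_iff; auto.
Qed.

Lemma branch_nonempty l2 x k : 0 < l2 -> 0 < x ->
  (0 <= k \/ k ^ 2 < x ^ 2 / l2 ^ 2 * (1 + k ^ 2)) -> exists T, on_branch l2 x k T.
Proof.
  intros Hl2 Hx Hk.
  assert (0 < x ^ 2 / l2 ^ 2) by (apply Rdiv_lt_0_compat; apply pow_lt; lra).
  destruct (gap_root_exists (x ^ 2 / l2 ^ 2) k) as (p & Hp & Hpk & HN & Eg); auto.
  destruct (branch_cot k p Hp Hpk HN) as (Hq & Hpq & _).
  set (q := num k p / den k p) in *.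
  destruct (shape_realized (x * q * (1 + p ^ 2) / (2 * (p + q))) p q) as (T & HT); auto.
  - apply Rdiv_lt_0_compat; [|lra].
    apply Rmult_lt_0_compat; [apply Rmult_lt_0_compat; auto | nra].
  - exists T. eexists; exists p. fold q. repeat split; auto; apply HT.
Qed.

Lemma branch_bound l2 x k T : on_branch l2 x k T ->
  0 <= k \/ k ^ 2 < x ^ 2 / l2 ^ 2 * (1 + k ^ 2).
Proof.
  intros (r & p & (Hp & Hpk & HN) & _ & _ & Eg). apply gap_root_bound with p; auto.
Qed.

Lemma branch_unique l2 x k S T :
  on_branch l2 x k S -> on_branch l2 x k T -> congruent S T.
Proof.
  intros (r & p & (Hp & Hpk & HN) & HS & Er & Eg)
    (r' & p' & (Hp' & Hpk' & HN') & HT & Er' & Eg').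
  assert (p = p') by (eapply gap_root_unique; eauto). subst p'.
  apply shape_congruent with r p (num k p / den k p); auto. rewrite Er, <- Er'. exact HT.
Qed.

(** [p] and [q] are congruence invariants and determine [k], so different branches share no
    congruence class. *)
Lemma branch_congruent l2 x k k' S T :
  on_branch l2 x k S -> on_branch l2 x k' T -> congruent S T -> k = k'.
Proof.
  intros (r & p & (Hp & Hpk & HN) & HS & Er & Eg)
    (r' & p' & (Hp' & Hpk' & HN') & HT & Er' & Eg') HST.
  destruct (congruent_shape_tan _ _ _ _ _ _ _ _ HS HT HST) as [<- Eq].
  destruct (branch_cot k p Hp Hpk HN) as (Hq & Hpq & Ec).
  destruct (branch_cot k' p Hp' Hpk' HN') as (_ & _ & Ec').
  rewrite <- Eq, Ec in Ec'. apply Rmult_eq_reg_r in Ec'; nra.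
Qed.

Lemma hb_starstar_lt l1 l2 x : 0 < l1 -> 0 < l2 -> 0 < x ->
  hb_starstar l1 l2 < x <-> l1 ^ 2 * l2 ^ 2 < x ^ 2 * (l1 ^ 2 + l2 ^ 2).
Proof.
  intros Hl1 Hl2 Hx. unfold hb_starstar.
  assert (Hs : 0 < l1 ^ 2 + l2 ^ 2) by nra.
  assert (Hg : 0 < sqrt (l1 ^ 2 + l2 ^ 2)) by (apply sqrt_lt_R0; exact Hs).
  rewrite <- (pow2_sqrt (l1 ^ 2 + l2 ^ 2)) by lra.
  rewrite sqrt_pow2 by lra. set (g := sqrt (l1 ^ 2 + l2 ^ 2)) in *.
  assert (E : l1 * l2 = l1 * l2 / g * g) by (field; lra).
  assert (0 < l1 * l2) by nra. assert (0 < x * g) by nra.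
  rewrite <- !Rpow_mult_distr. split; intros H1.
  - assert (l1 * l2 < x * g) by nra. nra.
  - assert (l1 * l2 < x * g) by nra. nra.
Qed.

Theorem mainTheorem8 :
  forall l1 l2 : R, 0 < l2 -> l2 <= l1 ->
  forall x : R,
    (hb_starstar l1 l2 < x < l1 ->
       exactly_up_to_congruence 2 (prescribed l1 l2 x)) /\
    ((0 < x <= hb_starstar l1 l2 \/ x = l1) ->
       exactly_up_to_congruence 1 (prescribed l1 l2 x)) /\
    (~ (hb_starstar l1 l2 < x < l1) ->
     ~ (0 < x <= hb_starstar l1 l2 \/ x = l1) ->
       ~ exists T : labelled_triangle, prescribed l1 l2 x T).
Proof.
  intros l1 l2 Hl2 Hle x. assert (Hl1 : 0 < l1) by lra.
  assert (Hstar : 0 < hb_starstar l1 l2 < l1).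
  { split.
    - apply Rdiv_lt_0_compat; [nra | apply sqrt_lt_R0; nra].
    - apply hb_starstar_lt; auto. assert (0 < l1 ^ 2) by nra. nra. }
  destruct (Rle_lt_dec x 0) as [Hx0|Hx].
  { repeat split; try lra. intros _ _ (T & HT%prescribed_pos). lra. }
  pose proof (hb_starstar_lt l1 l2 x Hl1 Hl2 Hx) as Hlt.
  (* An altitude longer than the bisector from the same vertex contradicts x^2 (1 + k^2) = l1^2. *)
  destruct (Rlt_le_dec l1 x) as [Hxl|Hxl].
  { repeat split; try lra. intros _ _ (T & HT).
    apply prescribed_branch in HT; auto. destruct HT as (k & Ek & _).
    assert (0 <= x ^ 2 * k ^ 2) by (apply Rmult_le_pos; apply pow2_ge_0). nra. }
  assert (Hx2 : 0 < x ^ 2) by nra.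
  assert (Hk0 : 0 <= l1 ^ 2 / x ^ 2 - 1).
  { replace (l1 ^ 2 / x ^ 2 - 1) with ((l1 ^ 2 - x ^ 2) / x ^ 2) by (field; lra).
    apply Rdiv_le_0_compat; nra. }
  set (k := sqrt (l1 ^ 2 / x ^ 2 - 1)).
  assert (Hk : 0 <= k) by apply sqrt_pos.
  assert (Ek : x ^ 2 * (1 + k ^ 2) = l1 ^ 2)
    by (unfold k; rewrite pow2_sqrt by exact Hk0; field; lra).
  clearbody k. clear Hk0.
  assert (Hcases : forall T, prescribed l1 l2 x T <->
    on_branch l2 x k T \/ on_branch l2 x (- k) T).
  { intros T. rewrite prescribed_branch by auto. split.
    - intros (k' & Ek' & HT).
      assert (Hkk : (k' - k) * (k' + k) = 0).
      { apply Rmult_eq_reg_l with (x ^ 2); [|lra].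
        transitivity (x ^ 2 * (1 + k' ^ 2) - x ^ 2 * (1 + k ^ 2)); [ring | lra]. }
      apply Rmult_integral in Hkk. destruct Hkk.
      + left. replace k with k' by lra. exact HT.
      + right. replace (- k) with k' by lra. exact HT.
    - intros [HT|HT]; [exists k | exists (- k)]; split; auto.
      rewrite <- Ek. ring. }
  (* Substituting k^2 = l1^2 / x^2 - 1 turns the existence condition on the branch [- k] into 1/x^2
     < 1/l1^2 + 1/l2^2. *)
  assert (Hneg : (- k) ^ 2 < x ^ 2 / l2 ^ 2 * (1 + (- k) ^ 2) <-> hb_starstar l1 l2 < x).
  { rewrite Hlt.
    replace (x ^ 2 / l2 ^ 2 * (1 + (- k) ^ 2)) with (x ^ 2 * (1 + k ^ 2) / l2 ^ 2)
      by (field; lra). rewrite Ek.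
    assert (Hl22 : 0 < l2 ^ 2) by nra.
    assert (E : x ^ 2 * (l1 ^ 2 + l2 ^ 2) - l1 ^ 2 * l2 ^ 2 =
       x ^ 2 * l2 ^ 2 * (l1 ^ 2 / l2 ^ 2 - (- k) ^ 2)).
    { transitivity (x ^ 2 * l1 ^ 2 + l2 ^ 2 * (x ^ 2 - x ^ 2 * (1 + k ^ 2)));
        [rewrite Ek; ring | field; lra]. }
    assert (0 < x ^ 2 * l2 ^ 2) by (apply Rmult_lt_0_compat; auto).
    split; intros H0; nra. }
  destruct (branch_nonempty l2 x k) as (T & HT); auto.
  repeat split.
  - intros [Hs Hl].
    (* [k = 0] would force [x = l1]; with [k > 0] the two branches are distinct. *)
    assert (0 < k) by (destruct Hk as [|<-]; [auto | nra]).
    destruct (branch_nonempty l2 x (- k)) as (T' & HT'); auto; [right; tauto|].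
    exists (T :: T' :: nil). repeat split.
    + repeat constructor; apply Hcases; auto.
    + repeat constructor. intros HC.
      pose proof (branch_congruent _ _ _ _ _ _ HT HT' HC). lra.
    + intros S [HS|HS]%Hcases.
      * apply Exists_cons_hd. eapply branch_unique; eauto.
      * apply Exists_cons_tl, Exists_cons_hd. eapply branch_unique; eauto.
  - intros H. exists (T :: nil). repeat split.
    + repeat constructor; apply Hcases; auto.
    + repeat constructor.
    + intros S HS. apply Exists_cons_hd. apply branch_unique with l2 x k; auto.
      (* In both cases a triangle on the branch [- k] forces [k = 0], so the two branches
         coincide. *)
      apply Hcases in HS. destruct HS as [|HS]; auto.
      destruct H as [H| ->].
      * destruct (branch_bound _ _ _ _ HS) as [|H0].
        -- replace k with (- k) by lra. exact HS.
        -- apply Hneg in H0. lra.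
      * assert (k = 0). { assert (l1 ^ 2 * k ^ 2 = 0) by lra. apply Rmult_integral in H as [H|H]; nra. }replace k with (- k) by lra. exact HS.
  - intros H1 H2 _. destruct (Rle_lt_dec x (hb_starstar l1 l2)); [tauto|].
    destruct Hxl; tauto.
Qed.
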